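(* Let $n\ge 2$, let $F$ be a field of order greater than $2$, and let $\Sigma_n$ be the $n$-dimensional projective space over $F$. Let $A,B$ be two simplexes in $\Sigma_n$ with no common point and no common hyperplane (face). If $A,B$ are in perspective from a hyperplane, then they are in perspective from a point.
   Context: Dimension means projective dimension. A simplex in $\Sigma_n$ is a set of $n+1$ points that generates $\Sigma_n$; its faces (hyperplanes) are the $(n-1)$-dimensional subspaces generated by $n$ of its points. Simplexes $A=\{A_i\}$ and $B=\{B_i\}$ (with $n+1$ points each, $A_i$ corresponding to $B_i$) are in perspective from a point $V$ if there are $n+1$ lines through $V$, the $i$-th one containing $A_i$ and $B_i$. A $t$-space of $A$ is the $t$-dimensional subspace generated by $t+1$ points $A_i$, $i\in I$, $|I|=t+1$; the corresponding $t$-space of $B$ is generated by the points $B_i$, $i\in I$. Simplexes $A,B$ of $\Sigma_n$ with no common points or faces are in perspective from a hyperplane $v$ if there is a correspondence between the points of $A$ and $B$ (and therefore between their subspaces) such that for each $t=1,2,\ldots,n-1$ the intersection of corresponding $t$-spaces of $A,B$ is a $(t-1)$-dimensional subspace lying in the fixed hyperplane $v$. *)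

(* Defs.v *)
From HB Require Import structures.
From mathcomp Require Import all_boot all_order all_fingroup all_algebra.

Set Implicit Arguments.
Unset Strict Implicit.
Unset Printing Implicit Defensive.

Import GRing.Theory.
Local Open Scope ring_scope.

(* Possibly infinite F: its order exceeds m iff F has m + 1 distinct elements. *)
Definition order_gt (F : fieldType) (m : nat) : Prop :=
  exists s : seq F, uniq s /\ (m < size s)%N.

Section ProjectiveSpace.

Variables (F : fieldType) (n : nat).

(* Projective subspaces of Sigma_n, as linear subspaces of F^(n+1). *)
Notation psubspace := {vspace 'rV[F]_n.+1}.

(* U has projective dimension t. *)
Definition pdim_is (U : psubspace) (t : nat) : Prop := \dim U = t.+1.

Definition ppoint (U : psubspace) : Prop := pdim_is U 0.
Definition pline (U : psubspace) : Prop := pdim_is U 1.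
Definition phyperplane (U : psubspace) : Prop := pdim_is U n.-1.

Definition generated (A : 'I_n.+1 -> psubspace) (I : {set 'I_n.+1}) :
  psubspace := (\sum_(i in I) A i)%VS.

Definition simplex (A : 'I_n.+1 -> psubspace) : Prop :=
  [/\ forall i, ppoint (A i), injective A & generated A setT = fullv].

Definition no_common_point (A B : 'I_n.+1 -> psubspace) : Prop :=
  forall i j, A i <> B j.

Definition no_common_face (A B : 'I_n.+1 -> psubspace) : Prop :=
  forall I J : {set 'I_n.+1}, #|I| = n -> #|J| = n ->
    generated A I <> generated B J.

(* In both notions of perspectivity the permutation s is the correspondence
   between the points of A and B: A i corresponds to B (s i). *)

(* The lines are pairwise distinct; V may be a point of A or B. *)
Definition perspective_from_point (A B : 'I_n.+1 -> psubspace)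
    (s : 'S_n.+1) (V : psubspace) : Prop :=
  ppoint V /\
  exists L : 'I_n.+1 -> psubspace,
    injective L /\
    forall i, [/\ pline (L i), (V <= L i)%VS, (A i <= L i)%VS
                & (B (s i) <= L i)%VS].

Definition perspective_from_hyperplane (A B : 'I_n.+1 -> psubspace)
    (s : 'S_n.+1) (v : psubspace) : Prop :=
  phyperplane v /\
  forall (t : nat) (I : {set 'I_n.+1}), (1 <= t <= n.-1)%N -> #|I| = t.+1 ->
    let U := (generated A I :&: generated (B \o s) I)%VS in
    pdim_is U t.-1 /\ (U <= v)%VS.

End ProjectiveSpace.

(* Main.v *)
(** Only the lines A_iA_j and B_iB_j are needed: they meet in a point of v, so
    any point common to the lines A_iB_i is a center of perspectivity, the lines
    A_iB_i being distinct because A_iA_j <> B_iB_j.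
    Let f be a linear form with kernel v.  If f vanishes at no vertex, scale the
    vertices to a_i, b_i with f = 1; then a_i - a_j and b_i - b_j both span the
    point of A_iA_j in v, so a_i - a_j = c (b_i - b_j) with c independent of i, j
    by linear independence, and a_i - c b_i is the center.  If f vanishes at some
    A_i, then for every A_j off v the point of A_iA_j in v is A_i, so A_i is on
    B_iB_j; as A_i <> B_i, there is a single A_k off v, and B_k is the center.
    The case where f vanishes at some B_i is symmetric. *)
Require Import Defs.
From HB Require Import structures.
From mathcomp Require Import all_boot all_order all_fingroup all_algebra.

Set Implicit Arguments.
Unset Strict Implicit.
Unset Printing Implicit Defensive.

Import GRing.Theory.

(** * Linear forms, dual families and proportional differences of vectors *)

Section VectorFamilies.

Local Open Scope ring_scope.

Variables (F : fieldType) (vT : vectType F).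

Lemma hyperplane_form (v : {vspace vT}) :
  (\dim v).+1 = \dim {:vT} ->
  exists f : {scalar vT}, forall u, (u \in v) = (f u == 0).
Proof.
move=> dimv.
have dimC : \dim v^C = 1%N by rewrite dimv_compl -dimv subSnn.
(* The complement of [v] is a line; the form reads the coordinate of [u - projv v u] along it, so it
   vanishes exactly when [u] is its own projection. *)
exists (coord (vbasis v^C) (cast_ord (esym dimC) ord0)
         \o (\1%VF - projv v)%R : {scalar vT}) => u /=.
rewrite !lfun_simp /=.
have ker_coord w : w \in (v^C)%VS ->
    (coord (vbasis v^C) (cast_ord (esym dimC) ord0) w == 0) = (w == 0).
  move=> wC; apply/eqP/eqP=> [c0|->]; last by rewrite linear0.
  rewrite (coord_vbasis wC) big1 // => i _.
  suff -> : i = cast_ord (esym dimC) ord0 by rewrite c0 scale0r.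
  by apply: val_inj; case: i => [[|i] lt_i] //=; rewrite dimC in lt_i.
rewrite ker_coord ?memv_projC // subr_eq0.
by apply/idP/eqP=> [/projv_id->|->] //; rewrite memv_proj.
Qed.

Lemma dim_vline1 (U : {vspace vT}) : \dim U = 1%N -> U = <[vpick U]>%VS.
Proof.
move=> dimU; apply/esym/eqP; rewrite eqEdim -memvE memv_pick dimU dim_vline.
by rewrite vpick0 -dimv_eq0 dimU.
Qed.

Lemma memv_add_lineP (u w p : vT) :
  reflect (exists k l, p = k *: u + l *: w) (p \in <[u]> + <[w]>)%VS.
Proof.
apply: (iffP memv_addP) => [[_ /vlineP[k ->] [_ /vlineP[l ->] ->]]|[k [l ->]]].
  by exists k, l.
by exists (k *: u); rewrite ?memvZ ?memv_line //;
   exists (l *: w); rewrite ?memvZ ?memv_line.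
Qed.

(** Spanning vectors as many as the dimension form a basis, and its coordinate forms are the dual
    family. *)
Lemma span_full_dual n (b : 'I_n -> vT) :
  \dim {:vT} = n -> (\sum_i <[b i]>)%VS = fullv ->
  exists e : 'I_n -> {scalar vT}, forall i j, e i (b j) = (j == i)%:R.
Proof.
move=> dimT full.
pose X := [tuple b i | i < n].
have Xnth (i : 'I_n) : X`_i = b i by rewrite -tnth_nth tnth_mktuple.
have freeX : free X.
  have: basis_of fullv X.
    rewrite basisEdim size_tuple dimT leqnn andbT -full.
    by apply/subv_sumP=> i _; rewrite -memvE -Xnth memv_span ?mem_nth ?size_tuple.
  exact: basis_free.
by exists (fun i => coord X i) => i j; rewrite /= -(Xnth j) coord_free.
Qed.

(** The ratios [c i] are taken against the reference index [i0] and compared through the difference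
    [a i - a j]. The form [e], which sees [b i0] alone, plays the role of linear independence. *)
Lemma common_center_of_parallel_differences (I : finType) (a b : I -> vT)
    (e : {scalar vT}) (i0 : I) :
  e (b i0) != 0 -> (forall i, i != i0 -> e (b i) = 0) ->
  (forall i j, i != j -> exists c, a i - a j = c *: (b i - b j)) ->
  exists V c, forall i, V = a i - c *: b i.
Proof.
move=> e0 eN0 par.
have [c ac] : exists c : I -> F,
    forall i, i != i0 -> a i - a i0 = c i *: (b i - b i0).
  apply: (fin_all_exists
    (P := fun i c => i != i0 -> a i - a i0 = c *: (b i - b i0))) => i.
  by have [->|/par[c ?]] := eqVneq i i0; [exists 0 | exists c].
have c_const i j : i != i0 -> j != i0 -> c i = c j.
  move=> Ni Nj; have [->//|/par[d ad]] := eqVneq i j.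
  have: c i *: (b i - b i0) - c j *: (b j - b i0) = d *: (b i - b j).
    by rewrite -!ac // -ad opprB addrA subrK.
  (* Under [e] the right side vanishes and the left side leaves [c i] and [c j] times the same
     nonzero scalar. *)
  move/(congr1 e); rewrite !(linearB, linearZ) /= (eN0 i Ni) (eN0 j Nj).
  rewrite !sub0r oppr0 mulr0.
  move/eqP; rewrite subr_eq0 => /eqP.
  by move/(mulIf (_ : - e (b i0) != 0)); apply; rewrite oppr_eq0.
have [i1 Ni1|all0] := pickP [pred i | i != i0]; last first.
  (* With [i0] as the only index any ratio works; 0 is chosen. *)
  exists (a i0), 0 => i; move: (all0 i) => /=; case: eqP => //= -> _.
  by rewrite scale0r subr0.
exists (a i0 - c i1 *: b i0), (c i1) => i; have [->//|Ni] := eqVneq i i0.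
rewrite -(c_const i) // -[a i](subrK (a i0)) ac // scalerBr.
by rewrite -[X in _ = X - _]addrA [X in _ = X - _]addrC addrK [RHS]addrC.
Qed.

(** * Centers for two families of vectors whose sides meet on a hyperplane *)

Section Perspective.

Variables (I : finType) (f : {scalar vT}).

(** Vector form of perspectivity from the hyperplane [f = 0] at [t = 1]: [p] spans a point of it
    common to the corresponding sides. *)
Definition sides_meet_on (a b : I -> vT) : Prop :=
  forall i j, i != j -> exists p, [/\ p != 0, f p = 0,
    (p \in <[a i]> + <[a j]>)%VS & (p \in <[b i]> + <[b j]>)%VS].

Lemma sides_meet_onC (a b : I -> vT) : sides_meet_on a b -> sides_meet_on b a.
Proof. by move=> m i j /m[p []]; exists p. Qed.

Lemma vertex_center (a b : I -> vT) (e : I -> {scalar vT}) (i0 k : I) :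
  (forall i j, e i (b j) = (j == i)%:R) -> (forall i, a i \notin <[b i]>%VS) ->
  sides_meet_on a b -> f (a i0) = 0 -> f (a k) != 0 ->
  forall i, (b k \in <[a i]> + <[b i]>)%VS.
Proof.
move=> eb ab m fi0 fk.
have on_side i j : f (a i) = 0 -> f (a j) != 0 ->
    exists g d, d != 0 /\ a i = g *: b i + d *: b j.
  move=> fi fj; have /m[p [p0 fp]] : i != j.
    by apply: contraNneq fj => <-; rewrite fi.
  move=> /memv_add_lineP[x [y pa]] /memv_add_lineP[g [d pb]].
  (* Since [f] vanishes at [p] and [a i] but not at [a j], the vector [p] is a multiple of [a i]. *)
  move: fp; rewrite pa linearD !linearZ /= fi mulr0 add0r => /eqP.
  rewrite mulf_eq0 (negPf fj) orbF => /eqP y0.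
  move: pa; rewrite y0 scale0r addr0 => pa.
  have x0 : x != 0 by apply: contraNneq p0 => x0; rewrite pa x0 scale0r.
  have aE : a i = (x^-1 * g) *: b i + (x^-1 * d) *: b j.
    by rewrite -!scalerA -scalerDr -pb pa scalerK.
  exists (x^-1 * g), (x^-1 * d); split=> //.
  apply: contra (ab i) => /eqP d0; rewrite aE d0 scale0r addr0.
  by rewrite memvZ ?memv_line.
move=> i; have [fi|fi] := eqVneq (f (a i)) 0.
  have [g [d [d0 aE]]] := on_side i k fi fk.
  (* These coefficients solve [a i = g *: b i + d *: b k] for [b k]. *)
  apply/memv_add_lineP; exists d^-1, (- (d^-1 * g)).
  by rewrite {1}aE scalerDr !scalerA mulVf // scale1r scaleNr addrAC subrr add0r.
have [<-|ik] := eqVneq i k; first exact: (subvP (addvSr _ _)) (memv_line _).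
(* A second index [i] with [f (a i)] nonzero is impossible: [a i0] would lie on the sides from
   [b i0] to [b i] and to [b k], and [e i] would give [d = 0]. *)
have ii0 : i0 == i = false by apply: contraNF fi => /eqP <-; rewrite fi0.
have [g [d [d0 aE]]] := on_side i0 i fi0 fi.
have [g' [d' [_ aE']]] := on_side i0 k fi0 fk.
have := congr1 (e i) aE'; rewrite aE !linearD !linearZ /= !eb ii0 eqxx.
by rewrite eq_sym (negPf ik) !mulr0 !add0r mulr1 => /eqP; rewrite (negPf d0).
Qed.

Lemma affine_center (a b : I -> vT) (e : I -> {scalar vT}) (i0 : I) :
  (forall i j, e i (b j) = (j == i)%:R) -> (forall i, a i \notin <[b i]>%VS) ->
  sides_meet_on a b -> (forall i, f (a i) != 0) -> (forall i, f (b i) != 0) ->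
  exists2 V, V != 0 & forall i, (V \in <[a i]> + <[b i]>)%VS.
Proof.
move=> eb ab m fa fb.
pose nrm (u : vT) := (f u)^-1 *: u.
(* After scaling to [f = 1], the point where a side meets the hyperplane is spanned by the
   difference of its ends. *)
have pointE u w x y p : f u != 0 -> f w != 0 ->
    p = x *: u + y *: w -> f p = 0 -> p = (x * f u) *: (nrm u - nrm w).
  move=> fu fw ->.
  have -> : f (x *: u + y *: w) = x * f u + y * f w by rewrite linearD !linearZ.
  move/eqP; rewrite addr_eq0 => /eqP fp.
  by rewrite scalerBr {2}fp /nrm scaleNr opprK !scalerA !mulfK.
have [||i j ij|V [c VE]] := @common_center_of_parallel_differences I
    (fun i => nrm (a i)) (fun i => nrm (b i)) (e i0) i0.
- by rewrite /nrm linearZ /= eb eqxx mulr1 invr_eq0.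
- by move=> i Ni; rewrite /nrm linearZ /= eb (negPf Ni) mulr0.
- have [p [p0 fp /memv_add_lineP[x [y pa]] /memv_add_lineP[g [d pb]]]] := m i j ij.
  have {}pa := pointE _ _ _ _ _ (fa i) (fa j) pa fp.
  have {}pb := pointE _ _ _ _ _ (fb i) (fb j) pb fp.
  have x0 : x * f (a i) != 0.
    by apply: contraNneq p0 => x0; rewrite pa x0 scale0r.
  exists ((x * f (a i))^-1 * (g * f (b i))).
  by rewrite -scalerA -pb {1}pa scalerK.
exists V => [|i]; last first.
  rewrite (VE i) /nrm scalerA -scaleNr.
  by apply/memv_add_lineP; exists (f (a i))^-1, (- (c * (f (b i))^-1)).
(* A zero center would make [a i0] a multiple of [b i0]. *)
apply: contraNneq (ab i0) => V0; have /eqP := VE i0.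
rewrite V0 eq_sym subr_eq0 => /eqP aE.
rewrite -[a i0](scalerK (invr_neq0 (fa i0))) -/(nrm _) aE.
by rewrite !memvZ ?memv_line.
Qed.

Lemma sides_meet_center (a b : I -> vT) (e e' : I -> {scalar vT}) (i0 : I) :
  (forall i j, e i (a j) = (j == i)%:R) -> (forall i j, e' i (b j) = (j == i)%:R) ->
  (forall i, <[a i]> <> <[b i]>)%VS -> sides_meet_on a b ->
  (exists k, f (a k) != 0) -> (exists k, f (b k) != 0) ->
  exists2 V, V != 0 & forall i, (V \in <[a i]> + <[b i]>)%VS.
Proof.
have nz (g : I -> {scalar vT}) (c : I -> vT)
    (dual : forall i j, g i (c j) = (j == i)%:R) k : c k != 0.
  apply/eqP=> ck; have := dual k k.
  by rewrite ck linear0 eqxx => /esym/eqP; rewrite oner_eq0.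
move=> ea eb ne m [k fk] [l fl].
have notin u w : u != 0 -> w != 0 -> <[u]>%VS <> <[w]>%VS -> u \notin <[w]>%VS.
  move=> u0 w0 uw; apply/negP=> uw'; apply: uw; apply/eqP.
  by rewrite eqEdim !dim_vline u0 w0 -memvE uw'.
have ab i : a i \notin <[b i]>%VS by apply: notin; rewrite ?(nz _ _ ea) ?(nz _ _ eb).
have ba i : b i \notin <[a i]>%VS.
  by apply: notin; rewrite ?(nz _ _ ea) ?(nz _ _ eb) // => /esym/ne.
have [/existsP[i /eqP fi]|/existsPn fa] := boolP [exists i, f (a i) == 0].
  by exists (b k); [exact: nz eb k | exact: vertex_center eb ab m fi fk].
have [/existsP[i /eqP fi]|/existsPn fb] := boolP [exists i, f (b i) == 0].
  exists (a l) => [|j]; first exact: nz ea l.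
  by rewrite addvC; apply: (vertex_center ea ba (sides_meet_onC m) fi fl).
exact: (affine_center i0 eb ab m fa fb).
Qed.

End Perspective.
End VectorFamilies.

(** * From simplexes of points to families of vectors and back *)

Section Simplexes.

Local Open Scope ring_scope.

Variables (F : fieldType) (n : nat).
Implicit Types (A B : 'I_n.+1 -> {vspace 'rV[F]_n.+1}).

Lemma generated_pair A (i j : 'I_n.+1) :
  i != j -> Defs.generated A [set i; j] = (A i + A j)%VS.
Proof. by move=> ij; rewrite /Defs.generated big_setU1 ?inE // big_set1. Qed.

Lemma dim_join_points (U W : {vspace 'rV[F]_n.+1}) :
  ppoint U -> ppoint W -> U <> W -> pline (U + W)%VS.
Proof.
rewrite /ppoint /pline /pdim_is => dU dW UW.
rewrite dimv_disjoint_sum ?dU ?dW //; apply/eqP; rewrite -dimv_eq0.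
have := dimvS (capvSl U W); rewrite dU leq_eqVlt => /orP[/eqP d1|]; last first.
  by rewrite ltnS leqn0.
case: UW; apply/eqP; rewrite eqEdim dU dW andbT.
suff /eqP <- : (U :&: W)%VS == U by exact: capvSr.
by rewrite eqEdim capvSl dU d1.
Qed.

Lemma perspective_from_joins A B (V : {vspace 'rV[F]_n.+1}) (s : 'S_n.+1) :
  (forall i, ppoint (A i)) -> (forall i, ppoint (B i)) ->
  injective A -> injective B -> no_common_point A B ->
  (forall i j, i != j -> (A i + A j)%VS <> (B (s i) + B (s j))%VS) ->
  ppoint V -> (forall i, (V <= A i + B (s i))%VS) ->
  perspective_from_point A B s V.
Proof.
move=> pA pB injA injB nAB sides pV VAB; split=> //.
exists (fun i => (A i + B (s i))%VS); split=> [i j Lij|i]; last first.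
  by split; rewrite ?addvSl ?addvSr //; apply: dim_join_points.
(* If two joins coincide, the common line contains all four vertices, so it equals both
   corresponding sides. *)
apply/eqP/negP=> /negP ij; case: (sides i j ij).
have dL : \dim (A i + B (s i)) = 2 by apply: dim_join_points.
transitivity (A i + B (s i))%VS; [|symmetry]; apply/eqP; rewrite eqEdim dL.
  rewrite subv_add addvSl Lij addvSl /=.
  by rewrite (dim_join_points (pA i) (pA j)) // => /injA /eqP; rewrite (negPf ij).
rewrite subv_add addvSr Lij addvSr /=.
rewrite (dim_join_points (pB _) (pB _)) // => /injB /perm_inj /eqP.
by rewrite (negPf ij).
Qed.

Lemma dim_rowspace : \dim {: 'rV[F]_n.+1} = n.+1.
Proof. by rewrite dimvf dim_matrix mul1r. Qed.

Lemma simplex_dual A : simplex A ->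
  exists e : 'I_n.+1 -> {scalar 'rV[F]_n.+1},
    forall i j, e i (vpick (A j)) = (j == i)%:R.
Proof.
case=> pA _ full; apply: span_full_dual; first exact: dim_rowspace.
rewrite -full /Defs.generated; apply: eq_big => i; first by rewrite inE.
by rewrite -dim_vline1 //; apply: pA.
Qed.

(** Renumbering [B] by [s] turns the correspondence into equality of indices. *)
Lemma simplex_perm A (s : 'S_n.+1) : simplex A -> simplex (A \o s).
Proof.
case=> pA injA full; split=> [i|i j /injA /perm_inj //|]; first exact: pA.
rewrite -full /Defs.generated [RHS](reindex_inj (@perm_inj _ s)) /=.
by apply: eq_bigl => i; rewrite !inE.
Qed.

Lemma simplex_not_sub A (v : {vspace 'rV[F]_n.+1}) : simplex A ->
  (\dim v < n.+1)%N -> exists k, vpick (A k) \notin v.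
Proof.
case=> pA _ full dv; apply/existsP; apply: contraTT dv => /existsPn Av.
rewrite -leqNgt; apply: leq_trans (eq_leq (esym dim_rowspace)) _.
rewrite -full; apply/dimvS/subv_sumP=> i _; rewrite (dim_vline1 (pA i)) -memvE.
by have := Av i; rewrite negbK.
Qed.

End Simplexes.

Theorem theorem8p3 (F : fieldType) (n : nat)
    (A B : 'I_n.+1 -> {vspace 'rV[F]_n.+1})
    (n_ge2 : 2 <= n) (F_gt2 : order_gt F 2)
    (simplexA : simplex A) (simplexB : simplex B)
    (no_point : no_common_point A B) (no_face : no_common_face A B)
    (s : 'S_n.+1) :
  (exists v : {vspace 'rV[F]_n.+1}, perspective_from_hyperplane A B s v) ->
  exists V : {vspace 'rV[F]_n.+1}, perspective_from_point A B s V.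
Proof.
case=> v [dimv persp].
have simplexBs := simplex_perm s simplexB.
have [[pA injA _] [pB injB _]] := (simplexA, simplexB).
have n_gt0 : (0 < n)%N by apply: leq_trans n_ge2.
have {}dimv : \dim v = n by rewrite dimv prednK.
have sides i j : i != j ->
    let U := ((A i + A j) :&: (B (s i) + B (s j)))%VS in
    \dim U = 1%N /\ (U <= v)%VS.
  (* The case [t = 1], admissible because [n] is at least 2; projective dimension 0 is linear
     dimension 1. *)
  move=> ij; have t1 : (1 <= 1 <= n.-1)%N by rewrite leqnn ltn_predRL.
  have := persp _ [set i; j] t1; rewrite cards2 ij !generated_pair //.
  exact.
have [f fv] : exists f : {scalar 'rV[F]_n.+1}, forall u, (u \in v) = (f u == 0)%R.
  by apply: hyperplane_form; rewrite dim_rowspace dimv.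
have [e eA] := simplex_dual simplexA.
have [e' eB] := simplex_dual simplexBs.
have AE i := dim_vline1 (pA i); have BE i := dim_vline1 (pB i).
have [||||V V0 VAB] :=
    @sides_meet_center _ _ _ f (fun i => vpick (A i))
      (fun i => vpick (B (s i))) e e' ord0 eA eB.
- by move=> i /=; rewrite -AE -BE; apply: no_point.
- move=> i j /sides[dU Uv] /=; rewrite -!AE -!BE.
  set U := (_ :&: _)%VS in dU Uv; exists (vpick U).
  rewrite vpick0 -dimv_eq0 dU; have := memv_pick U; rewrite memv_cap => /andP[-> ->].
  by split=> //; apply/eqP; rewrite -fv (subvP Uv) ?memv_pick.
- have [|k ?] := simplex_not_sub simplexA (v := v); first by rewrite dimv.
  by exists k; rewrite -fv.
- have [|k ?] := simplex_not_sub simplexBs (v := v); first by rewrite dimv.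
  by exists k; rewrite -fv.
exists <[V]>%VS; apply: perspective_from_joins => // [i j ij eq_sides| |i].
(* Equal corresponding sides would meet in a line, of linear dimension 2 instead of 1. *)
- have [] := sides i j ij; rewrite -eq_sides capvv.
  rewrite (dim_join_points (pA i) (pA j)) // => /injA /eqP.
  by rewrite (negPf ij).
- by rewrite /ppoint /pdim_is dim_vline V0.
by have := VAB i; rewrite /= -AE -BE -memvE.
Qed.
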